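(* Let $p\in(1,\infty)$ and let $\psi:[\tfrac12,1)\to(0,1]$ be the strictly decreasing function defined by \[\psi(x)=2\Big(x^{-\frac{1}{p-1}}+(1-x)^{-\frac{1}{p-1}}\Big)^{-\frac{p-1}{p}},\] with inverse $\psi^{-1}:(0,1]\to[\tfrac12,1)$. Let $\xi$ be a centered non-zero real-valued random variable with $\mathbb{E}|\xi|^p<\infty$. Then \[\mathbb{P}(\xi\ge 0)\ \ge\ \mathbb{P}(\xi>0)\ \ge\ \Big(\frac{c_{1,p}}{2}\Big)^{\frac{p}{p-1}}\big(\psi^{-1}(c_{1,p})\big)^{-\frac{1}{p-1}},\] and the same lower bound holds for $\mathbb{P}(\xi<0)$ and $\mathbb{P}(\xi\le 0)$. Moreover, the estimates for $\mathbb{P}(\xi\ge0)$ and $\mathbb{P}(\xi\le 0)$ are sharp: for every $c\in(0,1]$, the infimum of $\mathbb{P}(\xi\ge 0)$ over all centered non-zero real-valued random variables $\xi$ with $\mathbb{E}|\xi|^p<\infty$ and $c_{1,p}=c$ equals $\big(\frac{c}{2}\big)^{\frac{p}{p-1}}(\psi^{-1}(c))^{-\frac{1}{p-1}}$, and likewise for $\mathbb{P}(\xi\le 0)$. Furthermore, for every $p\in(1,\infty)$ and every such $\xi$, \[\mathbb{P}(\xi\ge 0)\ \ge\ \mathbb{P}(\xi>0)\ \ge\ \Big(\frac{c_{1,p}}{2}\Big)^{\frac{p}{p-1}}\Big(1-\Big(\Big(\frac{c_{1,p}}{2}\Big)^{-\frac{p}{p-1}}-1\Big)^{-(p-1)}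\Big)^{-\frac{1}{p-1}}.\]
   Context: A real-valued random variable $\xi$ is centered if $\mathbb{E}|\xi|<\infty$ and $\mathbb{E}\xi=0$; non-zero means that $\xi$ is not almost surely equal to $0$. For a random variable $\xi$ and $q\in[1,\infty)$, $c_q=(\mathbb{E}|\xi|^q)^{1/q}$, and $c_{1,p}=c_1/c_p$ (so $c_{1,p}\in(0,1]$). The infimum in the sharpness statement is over random variables on arbitrary probability spaces. *)

(* Defs.v *)
From HB Require Import structures.
From mathcomp Require Export all_boot all_order all_algebra.
From mathcomp Require Export all_classical all_reals all_analysis.
Export Order.TTheory GRing.Theory Num.Theory.
Export numFieldNormedType.Exports.

Set Implicit Arguments.
Unset Strict Implicit.
Unset Printing Implicit Defensive.

Local Open Scope classical_set_scope.
Local Open Scope ring_scope.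

Definition psi (R : realType) (p x : R) : R :=
  2 * (x `^ (- (p - 1)^-1) + (1 - x) `^ (- (p - 1)^-1)) `^ (- ((p - 1) / p)).

Definition psi_inv (R : realType) (p : R) : R -> R :=
  pinv (`[2^-1, 1[%classic : set R) (psi p).

Definition psi_bound (R : realType) (p c : R) : R :=
  (c / 2) `^ (p / (p - 1)) * psi_inv p c `^ (- (p - 1)^-1).

Definition explicit_bound (R : realType) (p c : R) : R :=
  (c / 2) `^ (p / (p - 1)) *
  (1 - ((c / 2) `^ (- (p / (p - 1))) - 1) `^ (- (p - 1))) `^ (- (p - 1)^-1).

Section random_variables.
Context d (T : measurableType d) (R : realType) (P : probability T R).
Implicit Types X : {RV P >-> R}.

Definition centered X : Prop :=
  ('E_P[(fun w => `|X w|)%R] < +oo)%E /\ ('E_P[X] = 0)%E.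

Definition nonzero X : Prop := ~ {ae P, forall w, X w = 0}.

Definition centered_nonzero_Lp (p : R) X : Prop :=
  [/\ centered X, nonzero X & ('E_P[(fun w => `|X w| `^ p)%R] < +oo)%E].

Definition moment_norm (q : R) X : R := fine ('N[P]_(q%:E)[EFin \o X])%E.

Definition moment_ratio (p : R) X : R := moment_norm 1 X / moment_norm p X.

End random_variables.

(* Values of P(X \in A) as the probability space and X both vary. *)
Definition attainable_probabilities (R : realType) (p c : R) (A : set R) :
    set (\bar R) :=
  [set r | exists (d : measure_display) (T : measurableType d)
             (P : probability T R) (X : {RV P >-> R}),
      [/\ centered_nonzero_Lp p X, moment_ratio p X = c & r = P (X @^-1` A)]].

(* Main.v *)
Require Import Defs.
From HB Require Import structures.
From mathcomp Require Import measurable_realfun ring lra.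

(** Write q = p/(p-1), a = 1/(p-1) and F(x) = x^(-a) + (1-x)^(-a), so that
    psi p x = 2 F(x)^(-1/q). The derivative of F is positive on ]1/2, 1[, whence
    psi decreases; it takes the value 1 at 1/2 and the intermediate value
    theorem makes it a bijection onto ]0, 1] (lemma psi_bij).

    Lower bound. Let X be centered and nonzero. Its positive and negative parts
    have the same mean m = E|X|/2 > 0, and E|X|^p = A + B where A and B are their
    p-th moments. Hoelder's inequality applied to each part and the indicator
    of its support gives m^q <= A^a P(X > 0) and m^q <= B^a P(X < 0) (lemmas
    hoelder_support and centered_moments). With c = 2m/(A+B)^(1/p) the moment
    ratio and s = A/(A+B), these read

      (c/2)^q s^(-a) <= P(X > 0),   (c/2)^q (1-s)^(-a) <= P(X < 0).

    The two probabilities add up to at most 1, so F(s) <= (c/2)^(-q) = F(t),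
    where t = psi_inv p c lies in [1/2, 1[. By monotonicity and symmetry of F
    this forces s <= t, and the first inequality becomes
    P(X > 0) >= (c/2)^q t^(-a), which is the bound (lemma psi_bound_le).
    Exchanging s with 1-s gives the bound for P(X < 0).

    Sharpness. For b = psi_bound p c, the variable with values 1/b and -1/(1-b)
    taken with probabilities b and 1-b has moment ratio exactly c and is
    nonnegative with probability b, so the infimum is a minimum (lemmas
    psi_bound_critical and attained_psi_bound); its opposite serves for
    P(X <= 0).

    Explicit bound. From F(t) = (c/2)^(-q) and t^(-a) >= 1 one gets an explicit
    upper bound of t, hence a lower bound of t^(-a) (lemma
    explicit_bound_le). *)

Set Implicit Arguments.
Unset Strict Implicit.
Unset Printing Implicit Defensive.

Local Open Scope classical_set_scope.
Local Open Scope ring_scope.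

(** * The function psi and its inverse *)

Lemma powRK_of_mul1 (R : realType) (x r s : R) :
  0 <= x -> r * s = 1 -> (x `^ r) `^ s = x.
Proof. by move=> x0 rs; rewrite -powRrM rs powRr1. Qed.

Lemma gt0_ltr_powRN (R : realType) (r x y : R) :
  0 < r -> 0 < x -> x < y -> y `^ (- r) < x `^ (- r).
Proof.
move=> r0 x0 xy; have y0 := lt_trans x0 xy.
rewrite !powRN ltf_pV2 ?posrE ?powR_gt0//.
by apply: gt0_ltr_powR; rewrite // nnegrE ltW.
Qed.

Lemma gt0_ler_powRN (R : realType) (r x y : R) :
  0 < r -> 0 < x -> x <= y -> y `^ (- r) <= x `^ (- r).
Proof.
move=> r0 x0; rewrite le_eqVlt => /predU1P[->//|xy].
exact/ltW/gt0_ltr_powRN.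
Qed.

(** With a = 1/(p-1), the function psi p is 2 F^(-(p-1)/p), where F is this
    sum: all the questions about psi become questions about F, which is smooth
    on ]0, 1[ and symmetric about 1/2. *)
Definition recip_powR_sum (R : realType) (a x : R) : R :=
  x `^ (- a) + (1 - x) `^ (- a).

Lemma recip_powR_sumC (R : realType) (a x : R) :
  recip_powR_sum a (1 - x) = recip_powR_sum a x.
Proof. by rewrite /recip_powR_sum subKr addrC. Qed.

Lemma recip_powR_sum_gt0 (R : realType) (a x : R) :
  0 < x -> 0 < recip_powR_sum a x.
Proof. by move=> x0; rewrite ltr_pwDl ?powR_gt0 ?powR_ge0. Qed.

Lemma is_derive_recip_powR_sum (R : realType) (a x : R) : 0 < x < 1 ->
  is_derive x 1 (@recip_powR_sum R a)
    (a * ((1 - x) `^ (- a - 1) - x `^ (- a - 1))).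
Proof.
move=> /andP[x0 x1]; have x1' : 0 < 1 - x by rewrite subr_gt0.
have d1 := is_derive1_powR (- a) x0.
have d2 : is_derive x 1 ((fun y : R => y `^ (- a)) \o (fun y => 1 - y))
    (- a * (1 - x) `^ (- a - 1) * (0 - 1)).
  apply: is_derive1_comp; exact: is_derive1_powR.
have := is_deriveD d1 d2.
rewrite (_ : _ + _ = a * ((1 - x) `^ (- a - 1) - x `^ (- a - 1)))//.
by rewrite sub0r; ring.
Qed.

Lemma continuous_recip_powR_sum (R : realType) (a x : R) : 0 < x < 1 ->
  {for x, continuous (@recip_powR_sum R a)}.
Proof.
move=> x01; apply: differentiable_continuous; apply/derivable1_diffP.
by have [] := is_derive_recip_powR_sum a x01.
Qed.

Lemma recip_powR_sum_incr (R : realType) (a : R) : 0 < a ->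
  {in `[2^-1, 1[ &, {homo @recip_powR_sum R a : x y / x < y}}.
Proof.
move=> a0; have half0 : 0 < 2^-1 :> R by rewrite invr_gt0.
apply: gtr0_derive1_lt_co => [x|x|].
- rewrite in_itv/= => /andP[x2 x1].
  have x01 : 0 < x < 1 by rewrite (lt_trans half0 x2).
  by have [] := is_derive_recip_powR_sum a x01.
- rewrite in_itv/= => /andP[x2 x1].
  have x01 : 0 < x < 1 by rewrite (lt_trans half0 x2).
  rewrite derive1E; have [_ ->] := is_derive_recip_powR_sum a x01.
  rewrite mulr_gt0// subr_gt0 -opprD; apply: gt0_ltr_powRN; lra.
- apply: continuous_in_subspaceT => x; rewrite inE/= in_itv/= => /andP[x2 x1].
  by apply: continuous_recip_powR_sum; rewrite (lt_le_trans half0 x2).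
Qed.

Lemma psi_recip (R : realType) (p x : R) :
  psi p x = 2 * recip_powR_sum (p - 1)^-1 x `^ (- (p / (p - 1))^-1).
Proof. by rewrite /psi invf_div. Qed.

Lemma psi_decr (R : realType) (p : R) : 1 < p ->
  {in `[2^-1, 1[ &, forall x y : R, x < y -> psi p y < psi p x}.
Proof.
move=> p1 x y x01 y01 xy; rewrite !psi_recip ltr_pM2l//.
apply: gt0_ltr_powRN.
- by rewrite invr_gt0 divr_gt0//; lra.
- by apply: recip_powR_sum_gt0; move: x01; rewrite in_itv/=; lra.
- by apply: recip_powR_sum_incr; rewrite ?invr_gt0 ?subr_gt0.
Qed.

Lemma psi_half (R : realType) (p : R) : 1 < p -> psi p 2^-1 = 1.
Proof.
move=> p1; have p10 : p - 1 != 0 by lra.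
have p0 : p != 0 by lra.
have half_pow r : 2^-1 `^ (- r) = 2 `^ r :> R.
  by rewrite -powR_inv1// -powRrM mulN1r opprK.
rewrite psi_recip /recip_powR_sum (_ : 1 - 2^-1 = 2^-1); last lra.
have double r : 2 `^ r + 2 `^ r = 2 `^ (1 + r) :> R.
  by rewrite powRD ?pnatr_eq0 ?implybT// powRr1// mulrDl !mul1r.
rewrite half_pow double.
rewrite -powRrM (_ : _ * - _ = -1) ?powR_inv1 ?divff//.
by field; rewrite p0 p10.
Qed.

Lemma recip_powR_sum_of_psi (R : realType) (p x : R) : 1 < p ->
  recip_powR_sum (p - 1)^-1 x = (psi p x / 2) `^ (- (p / (p - 1))).
Proof.
move=> p1; rewrite psi_recip mulrAC divff// mul1r powRK_of_mul1//.
  by rewrite addr_ge0// powR_ge0.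
by field; lra.
Qed.

(** F is continuous with F(1/2) = 2^(p/(p-1)), so by the intermediate value
    theorem it is enough to exhibit a point where F exceeds
    (c/2)^(-p/(p-1)). *)
Lemma psi_surj (R : realType) (p : R) : 1 < p ->
  set_surj `[2^-1, 1[ `]0, 1] (psi p).
Proof.
move=> p1 c /=; rewrite in_itv/= => /andP[c0 c1].
set a := (p - 1)^-1; set q := p / (p - 1).
have q0 : 0 < q by rewrite divr_gt0//; lra.
have c20 : 0 < c / 2 by rewrite divr_gt0.
(* At this u the second summand of F alone equals (c/2)^(-p/(p-1)). *)
pose u := 1 - (c / 2) `^ p.
have cp : (c / 2) `^ p <= 2^-1.
  have := @ge1r_powR _ (c / 2) p; rewrite c20 /=; lra.
have u2 : 2^-1 <= u by rewrite /u; lra.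
have u1 : u < 1 by rewrite /u; have := powR_gt0 p c20; lra.
have Fhalf : recip_powR_sum a 2^-1 <= (c / 2) `^ (- q).
  rewrite recip_powR_sum_of_psi// psi_half//; apply: gt0_ler_powRN => //.
  by rewrite ler_pM2r.
have Fu : (c / 2) `^ (- q) <= recip_powR_sum a u.
  rewrite /recip_powR_sum subKr -powRrM (_ : p * - a = - q) ?lerDr ?powR_ge0//.
  by rewrite /a /q; ring.
have [||t tu Ft] := @IVT R (recip_powR_sum a) 2^-1 u ((c / 2) `^ (- q)) u2.
- apply: continuous_in_subspaceT => x; rewrite inE/= in_itv/= => /andP[x2 xu].
  apply: continuous_recip_powR_sum; apply/andP; split; lra.
- by rewrite ge_min Fhalf le_max Fu orbT.
exists t => /=; first by move: tu; rewrite !in_itv/=; lra.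
rewrite psi_recip -/a -/q Ft powRK_of_mul1//; first by field.
- exact: ltW.
- by field; lra.
Qed.

Lemma psi_bij (R : realType) (p : R) : 1 < p ->
  set_bij `[2^-1, 1[ `]0, 1] (psi p).
Proof.
move=> p1; split; last exact: psi_surj.
- move=> x /= x01; rewrite in_itv/=; apply/andP; split.
    rewrite psi_recip mulr_gt0// powR_gt0// recip_powR_sum_gt0//.
    by move: x01; rewrite in_itv/=; lra.
  have [<-|x2] := eqVneq 2^-1 x; first by rewrite psi_half.
  rewrite -(psi_half p1) ltW// psi_decr// ?in_itv/=; first lra.
  by move: x01; rewrite in_itv/= => /andP[x2' _]; rewrite lt_neqAle x2.
- move=> x y /set_mem x01 /set_mem y01 xy; apply/eqP.
  case: (ltgtP x y) => [ltxy|ltyx|_]; last by [].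
  - by have := psi_decr p1 x01 y01 ltxy; rewrite xy ltxx.
  - by have := psi_decr p1 y01 x01 ltyx; rewrite xy ltxx.
Qed.

Lemma psi_invP (R : realType) (p c : R) : 1 < p -> 0 < c <= 1 ->
  2^-1 <= psi_inv p c < 1 /\ psi p (psi_inv p c) = c.
Proof.
move=> p1 c01; have c01' : c \in (`]0, 1]%classic : set R) by rewrite inE/= in_itv.
split; last exact: (@surjpK _ _ (fun=> point) _ _ _ (psi_surj p1)).
have := @surjpinv_image_sub _ _ (fun=> point) _ _ _ (psi_surj p1).
move=> /(_ (psi_inv p c)); rewrite /= in_itv/=; apply.
by exists c => //; rewrite in_itv.
Qed.

Lemma recip_powR_sum_psi_inv (R : realType) (p c : R) : 1 < p -> 0 < c <= 1 ->
  recip_powR_sum (p - 1)^-1 (psi_inv p c) = (c / 2) `^ (- (p / (p - 1))).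
Proof.
by move=> p1 c01; rewrite recip_powR_sum_of_psi//; have [_ ->] := psi_invP p1 c01.
Qed.

(** The optimization behind the lower bound. Here s stands for the share of
    E|X|^p carried by the positive part of X, and x, y for P(X > 0), P(X < 0);
    the last two hypotheses are what Hoelder's inequality gives for the two
    parts. Adding them yields F(s) <= (c/2)^(-p/(p-1)) = F(t) with
    t = psi_inv p c; since F increases on [1/2, 1[ and is symmetric, s <= t, and
    the bound on x is smallest at s = t. The same sum shows that c <= 1, because
    F is at least F(1/2). *)
Lemma psi_bound_le (R : realType) (p c s x y : R) : 1 < p -> 0 < c ->
  0 < s < 1 -> x + y <= 1 ->
  (c / 2) `^ (p / (p - 1)) * s `^ (- (p - 1)^-1) <= x ->
  (c / 2) `^ (p / (p - 1)) * (1 - s) `^ (- (p - 1)^-1) <= y ->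
  c <= 1 /\ psi_bound p c <= x.
Proof.
move=> p1 c0 /andP[s0 s1] xy hx hy.
set a := (p - 1)^-1 in hx hy *; set q := p / (p - 1) in hx hy *.
have a0 : 0 < a by rewrite invr_gt0; lra.
have q0 : 0 < q by rewrite divr_gt0//; lra.
have c20 : 0 < c / 2 by rewrite divr_gt0.
have Fs : recip_powR_sum a s <= (c / 2) `^ (- q).
  rewrite powRN -[leRHS]mul1r ler_pdivlMr ?powR_gt0//.
  by rewrite mulrC /recip_powR_sum mulrDr; lra.
have c1 : c <= 1.
  rewrite leNgt; apply/negP => c1.
  have F1 : recip_powR_sum a s < recip_powR_sum a 2^-1.
    apply: (le_lt_trans Fs); rewrite recip_powR_sum_of_psi// psi_half//.
    by apply: gt0_ltr_powRN; rewrite // ltr_pM2r.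
  (* F is symmetric, so s may be moved to the half where F increases. *)
  wlog s2 : s {xy hx hy Fs} s0 s1 F1 / 2^-1 <= s => [wlg|].
    have [s2|s2] := leP 2^-1 s; first exact: (wlg s).
    by apply: (wlg (1 - s)); rewrite ?recip_powR_sumC//; lra.
  move: F1; rewrite ltNge => /negP; apply.
  have [<-//|s2'] := eqVneq 2^-1 s.
  have lt2s : 2^-1 < s by rewrite lt_neqAle s2'.
  by apply/ltW/recip_powR_sum_incr; rewrite ?in_itv//=; lra.
split=> //; have c01 : 0 < c <= 1 by rewrite c0.
have [/andP[t2 t1] _] := psi_invP p1 c01; rewrite /psi_bound.
set t := psi_inv p c in t2 t1 *.
apply: le_trans hx; rewrite ler_wpM2l ?powR_ge0//; apply: gt0_ler_powRN => //.
rewrite leNgt; apply/negP => ts.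
have : recip_powR_sum a t < recip_powR_sum a s.
  apply: recip_powR_sum_incr => //; rewrite in_itv/=; lra.
by rewrite recip_powR_sum_psi_inv// ltNge Fs.
Qed.

(** In F(t) = S, with t = psi_inv p c and S = (c/2)^(-p/(p-1)), the summand
    t^(-1/(p-1)) is at least 1; hence (1-t)^(-1/(p-1)) <= S - 1, which bounds t
    above by the expression that replaces it in the explicit bound. *)
Lemma explicit_bound_le (R : realType) (p c : R) : 1 < p -> 0 < c <= 1 ->
  explicit_bound p c <= psi_bound p c.
Proof.
move=> p1 c01; have [/andP[t2 t1] _] := psi_invP p1 c01.
have := recip_powR_sum_psi_inv p1 c01.
rewrite /psi_bound /explicit_bound; set t := psi_inv p c in t2 t1 *.
set S := (c / 2) `^ (- (p / (p - 1))) => FS.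
rewrite ler_wpM2l ?powR_ge0//; apply: gt0_ler_powRN; first by rewrite invr_gt0; lra.
- lra.
have a0 : 0 < (p - 1)^-1 by rewrite invr_gt0; lra.
have S1 : (1 - t) `^ (- (p - 1)^-1) <= S - 1.
  have := @gt0_ler_powRN _ _ t 1 a0; rewrite powR1 -FS /recip_powR_sum; lra.
suff : (S - 1) `^ (- (p - 1)) <= 1 - t by lra.
rewrite -[leRHS](@powRK_of_mul1 _ _ (- (p - 1)^-1) (- (p - 1))); last 2 first.
- lra.
- by field; lra.
by apply: gt0_ler_powRN; rewrite ?subr_gt0// powR_gt0// subr_gt0.
Qed.

(** * Hoelder's inequality on the two parts of a centered variable *)

Lemma measurable_ltr_set d (T : measurableType d) (R : realType)
    (f g : T -> R) : measurable_fun setT f -> measurable_fun setT g ->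
  measurable [set w | f w < g w].
Proof.
move=> mf mg; rewrite -[X in measurable X]setTI.
exact: (measurable_fun_ltr mf mg measurableT (Y := [set true])).
Qed.

Lemma measurable_ler_set d (T : measurableType d) (R : realType)
    (f g : T -> R) : measurable_fun setT f -> measurable_fun setT g ->
  measurable [set w | f w <= g w].
Proof.
move=> mf mg; rewrite -[X in measurable X]setTI.
exact: (measurable_fun_ler mf mg measurableT (Y := [set true])).
Qed.

(** Hoelder's inequality for the product of f with the indicator of its own
    support, raised to the power q = p/(p-1). *)
Lemma hoelder_support d (T : measurableType d) (R : realType)
    (P : probability T R) (f : T -> R) (p m A x : R) :
  1 < p -> measurable_fun setT f -> (forall w, 0 <= f w) ->
  (\int[P]_w (f w)%:E = m%:E)%E ->
  (\int[P]_w (f w `^ p)%R%:E = A%:E)%E ->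
  (P [set w | 0 < f w]%R = x%:E)%E ->
  m `^ (p / (p - 1)) <= A `^ ((p - 1)^-1) * x.
Proof.
move=> p1 mf f0 fm fA fx.
have p0 : 0 < p by lra.
set q := p / (p - 1).
have q0 : 0 < q by rewrite divr_gt0//; lra.
have pq : p^-1 + q^-1 = 1 by rewrite /q; field; lra.
have mD : measurable [set w | 0 < f w] by exact: measurable_ltr_set.
have m0 : 0 <= m.
  by rewrite -lee_fin -fm integral_ge0// => w _; rewrite lee_fin.
have A0 : 0 <= A.
  by rewrite -lee_fin -fA integral_ge0// => w _; rewrite lee_fin powR_ge0.
have x0 : 0 <= x by rewrite -lee_fin -fx.
have N1 : ('N[P]_1[EFin \o (f \* \1_[set w | 0 < f w])%R] = m%:E)%E.
  rewrite -fm Lnorm1; apply: eq_integral => w _ /=; congr EFin.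
  rewrite indicE; case: (boolP (w \in _)) => [_|]; first by rewrite mulr1 ger0_norm.
  rewrite notin_setE/= => /negP; rewrite -leNgt => fw.
  by rewrite mulr0 normr0; apply/eqP; rewrite eq_le f0 fw.
have Np : ('N[P]_p%:E[EFin \o f] = (A `^ p^-1)%R%:E)%E.
  rewrite -poweR_EFin -fA unlock; congr (_ `^ _)%E.
  by apply: eq_integral => w _ /=; rewrite ger0_norm.
have Nq : ('N[P]_q%:E[EFin \o \1_[set w | (0 < f w)%R]] = (x `^ q^-1)%R%:E)%E.
  rewrite -poweR_EFin -fx -[X in P X]setIT -integral_indic// unlock.
  congr (_ `^ _)%E; apply: eq_integral => w _ /=; rewrite indicE.
  by case: (w \in _); rewrite ?normr1 ?powR1 ?normr0 ?powR0 ?gt_eqF.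
have := hoelder P mf (@measurable_indic _ _ R setT _ mD) p0 q0 pq.
rewrite N1 Np Nq lee_fin => H.
have := ge0_ler_powR (ltW q0) _ _ H.
rewrite !nnegrE m0 mulr_ge0 ?powR_ge0// powRM ?powR_ge0// => /(_ isT isT).
rewrite (powRK_of_mul1 x0) ?mulVf ?gt_eqF//.
by rewrite -powRrM (_ : _^-1 * q = (p - 1)^-1)// /q; field; lra.
Qed.

(** Centering enters only here: the positive and negative parts of X have the
    same mean m, which is half of E|X|, while E|X|^p splits as A + B. Both
    parts then satisfy the support inequality above with the same left-hand
    side. *)
Lemma centered_moments d (T : measurableType d) (R : realType)
    (P : probability T R) (p : R) (X : {RV P >-> R}) :
  1 < p -> centered_nonzero_Lp p X ->
  exists m A B x y : R,
    [/\ [/\ 0 < m, 0 <= A & 0 <= B],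
        P [set w | 0 < X w] = x%:E, P [set w | X w < 0] = y%:E, x + y <= 1
      & [/\ moment_ratio p X = 2 * m / (A + B) `^ p^-1,
            m `^ (p / (p - 1)) <= A `^ ((p - 1)^-1) * x
          & m `^ (p / (p - 1)) <= B `^ ((p - 1)^-1) * y]].
Proof.
move=> p1 [[X1 EX] nX Xp].
have p0 : 0 < p by lra.
have mX : measurable_fun setT X by [].
rewrite unlock in X1; rewrite unlock in EX; rewrite unlock in Xp.
have mpow (g : T -> R) : measurable_fun setT g -> measurable_fun setT (fun w => (g w `^ p)%:E).
  by move=> mg; apply/measurable_EFinP; exact: (@measurableT_comp _ _ _ _ _ _ (@powR R ^~ p)).
have mpos : measurable_fun setT X^\+ by exact: measurable_funrpos.
have mneg : measurable_fun setT X^\- by exact: measurable_funrneg.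
have absE w : `|X w| = X^\+ w + X^\- w by have := funrposDneg X => /(congr1 (@^~ w)).
have powE w : `|X w| `^ p = X^\+ w `^ p + X^\- w `^ p.
  rewrite absE /funrpos /funrneg; case: (lerP (X w) 0) => Xw.
    by rewrite max_l ?oppr_ge0// add0r powR0 ?gt_eqF// add0r.
  by rewrite max_r ?oppr_le0 ?ltW// addr0 powR0 ?gt_eqF// addr0.
have sum1 : (\int[P]_w `|X w|%R%:E = \int[P]_w (X^\+ w)%R%:E + \int[P]_w (X^\- w)%R%:E)%E.
  under eq_integral do rewrite absE EFinD.
  by rewrite ge0_integralD//; try exact/measurable_EFinP; move=> w _; rewrite lee_fin.
have sump : (\int[P]_w (`|X w| `^ p)%R%:E =
    \int[P]_w (X^\+ w `^ p)%R%:E + \int[P]_w (X^\- w `^ p)%R%:E)%E.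
  under eq_integral do rewrite powE EFinD.
  by rewrite ge0_integralD//; try exact: mpow; move=> w _; rewrite lee_fin powR_ge0.
have fin_of (g h : T -> R) : (forall w, 0 <= g w) -> (forall w, 0 <= h w) ->
  (\int[P]_w (g w)%:E + \int[P]_w (h w)%:E < +oo)%E ->
  exists2 a, 0 <= a & (\int[P]_w (g w)%:E = a%:E)%E.
  move=> g0 h0.
  have : (0 <= \int[P]_w (g w)%:E)%E by apply: integral_ge0 => w _; rewrite lee_fin.
  have : (0 <= \int[P]_w (h w)%:E)%E by apply: integral_ge0 => w _; rewrite lee_fin.
  case: (\int[P]_w (g w)%:E)%E => [a| |]; case: (\int[P]_w (h w)%:E)%E => //.
  by move=> b _ a0 _; exists a.
have pos0 w : 0 <= X^\+ w by [].
have neg0 w : 0 <= X^\- w by [].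
have ppos0 w : 0 <= X^\+ w `^ p by exact: powR_ge0.
have pneg0 w : 0 <= X^\- w `^ p by exact: powR_ge0.
rewrite sum1 in X1; rewrite sump in Xp.
have [m m0 Em] := fin_of _ _ pos0 neg0 X1.
have [A A0 EA] := fin_of _ _ ppos0 pneg0 Xp.
rewrite addeC in X1; rewrite addeC in Xp.
have [m' m'0 Em'] := fin_of _ _ neg0 pos0 X1.
have [B B0 EB] := fin_of _ _ pneg0 ppos0 Xp.
have mm' : m' = m.
  move: EX; under eq_integral do rewrite -{1}(funrposBneg X) EFinB.
  rewrite integralB//; last 2 first.
  - apply/integrableP; split; first exact/measurable_EFinP.
    by under eq_integral do rewrite gee0_abs ?lee_fin//; rewrite Em ltry.
  - apply/integrableP; split; first exact/measurable_EFinP.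
    by under eq_integral do rewrite gee0_abs ?lee_fin//; rewrite Em' ltry.
  by rewrite Em Em' -EFinB => -[] /eqP; rewrite subr_eq0 => /eqP.
have mgt0 : 0 < m.
  rewrite lt_neqAle m0 andbT; apply/eqP => m00; apply: nX.
  have /ae_eq_integral_abs : measurable_fun setT (EFin \o X) by exact/measurable_EFinP.
  move=> /(_ P measurableT) [+ _].
  rewrite /= sum1 Em Em' mm' -m00 addr0 => /(_ erefl).
  by apply: filterS => w /(_ I) [].
have finP (S : set T) : measurable S -> P S = (fine (P S))%:E.
  by move=> mS; rewrite fineK// fin_num_measure.
have posE w : (0 < X^\+ w) = (0 < X w).
  by rewrite /funrpos lt_max ltxx orbF.
have negE w : (0 < X^\- w) = (X w < 0).
  by rewrite /funrneg lt_max ltxx orbF oppr_gt0.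
have mP : measurable [set w | 0 < X w] by exact: measurable_ltr_set.
have mN : measurable [set w | X w < 0] by exact: measurable_ltr_set.
exists m, A, B, (fine (P [set w | 0 < X w])), (fine (P [set w | X w < 0])).
split => //.
- exact: finP.
- exact: finP.
- rewrite -lee_fin EFinD -!finP// -measureU//.
    exact: probability_le1 (measurableU _ _ _ _).
  by rewrite -subset0 => w [/= /ltW]; rewrite leNgt => /negP.
split.
- rewrite /moment_ratio /moment_norm Lnorm1/= sum1 Em Em' mm'/= unlock.
  by rewrite sump EA EB /= [2 * m]mulr_natl mulr2n.
- apply: (@hoelder_support _ _ _ P _ _ _ _ _ p1 mpos pos0 Em EA).
  by rewrite -finP//; congr (P _); apply/funext => w /=; rewrite posE.
- rewrite -mm'; apply: (@hoelder_support _ _ _ P _ _ _ _ _ p1 mneg neg0 Em' EB).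
  by rewrite -finP//; congr (P _); apply/funext => w /=; rewrite negE.
Qed.

(** Dividing the support inequalities by a power of A + B brings them to the
    scale-invariant form required by the optimization, with s = A / (A + B). *)
Lemma psi_bound_le_moments (R : realType) (p m A B x y c : R) :
  1 < p -> 0 < m -> 0 <= A -> 0 <= B -> x + y <= 1 ->
  c = 2 * m / (A + B) `^ p^-1 ->
  m `^ (p / (p - 1)) <= A `^ ((p - 1)^-1) * x ->
  m `^ (p / (p - 1)) <= B `^ ((p - 1)^-1) * y ->
  [/\ 0 < c, c <= 1 & psi_bound p c <= x].
Proof.
move=> p1 m0 A0 B0 xy cE hA hB.
have a0 : 0 < (p - 1)^-1 by rewrite invr_gt0; lra.
have mq0 := powR_gt0 (p / (p - 1)) m0.
have Agt0 : 0 < A.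
  rewrite lt_neqAle A0 andbT; apply/eqP => A00; move: hA.
  by rewrite -A00 powR0 ?gt_eqF// mul0r leNgt mq0.
have Bgt0 : 0 < B.
  rewrite lt_neqAle B0 andbT; apply/eqP => B00; move: hB.
  by rewrite -B00 powR0 ?gt_eqF// mul0r leNgt mq0.
have AB0 : 0 < A + B by lra.
have N0 := powR_gt0 p^-1 AB0.
have c0 : 0 < c by rewrite cE divr_gt0// mulr_gt0.
(* The powers of A + B cancel: 1/p * p/(p-1) = 1/(p-1). *)
have share D : 0 < D ->
    (c / 2) `^ (p / (p - 1)) * (D / (A + B)) `^ (- (p - 1)^-1)
    = m `^ (p / (p - 1)) / D `^ ((p - 1)^-1).
  move=> D0; rewrite (_ : c / 2 = m * (A + B) `^ (- p^-1)); last first.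
    by rewrite powRN cE; field; rewrite gt_eqF.
  rewrite powRM ?powR_ge0 ?ltW// -powRrM.
  rewrite (_ : - p^-1 * _ = - (p - 1)^-1); last by field; lra.
  rewrite -mulrA -powRM ?powR_ge0 ?divr_ge0 ?ltW//.
  by rewrite mulrCA divff ?mulr1 ?powRN// gt_eqF.
have s01 : 0 < A / (A + B) < 1.
  by rewrite divr_gt0// ltr_pdivrMr// mul1r ltrDl.
have sC : 1 - A / (A + B) = B / (A + B) by field; rewrite gt_eqF.
have [||c1 bx] := psi_bound_le p1 c0 s01 xy; last by [].
- by rewrite share// ler_pdivrMr ?powR_gt0// [x * _]mulrC.
- by rewrite sC share// ler_pdivrMr ?powR_gt0// [y * _]mulrC.
Qed.

(** * The extremal two-point variables *)

(** Since F(psi_inv p c) = (c/2)^(-p/(p-1)), the bound is the fraction of F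
    contributed by its first summand; the complement is the fraction contributed
    by the second. *)
Lemma psi_bound_conj (R : realType) (p c : R) : 1 < p -> 0 < c <= 1 ->
  1 - psi_bound p c =
  (c / 2) `^ (p / (p - 1)) * (1 - psi_inv p c) `^ (- (p - 1)^-1).
Proof.
move=> p1 c01; have /andP[c0 _] := c01.
apply/eqP; rewrite subr_eq /psi_bound -mulrDr [X in _ * X]addrC.
rewrite -/(recip_powR_sum (p - 1)^-1 (psi_inv p c)) recip_powR_sum_psi_inv//.
by rewrite powRN divff// gt_eqF// powR_gt0// divr_gt0.
Qed.

Lemma psi_bound_itv (R : realType) (p c : R) : 1 < p -> 0 < c <= 1 ->
  0 < psi_bound p c < 1.
Proof.
move=> p1 c01; have /andP[c0 _] := c01.
have [/andP[t2 t1] _] := psi_invP p1 c01.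
rewrite -[X in _ && X]subr_gt0 psi_bound_conj//.
by rewrite !mulr_gt0 ?powR_gt0 ?divr_gt0 ?subr_gt0//; lra.
Qed.

(** The left-hand side is E|X|^p for the two-point variable X that takes the
    values 1/b and -1/(1-b) with probabilities b = psi_bound p c and 1 - b. As
    E|X| = 2, the identity says that its moment ratio is c. *)
Lemma psi_bound_critical (R : realType) (p c : R) : 1 < p -> 0 < c <= 1 ->
  psi_bound p c `^ (- (p - 1)) + (1 - psi_bound p c) `^ (- (p - 1)) =
  (c / 2) `^ (- p).
Proof.
move=> p1 c01; have /andP[c0 _] := c01.
have [/andP[t2 t1] _] := psi_invP p1 c01.
have pow s : 0 <= s -> ((c / 2) `^ (p / (p - 1)) * s `^ (- (p - 1)^-1)) `^ (- (p - 1))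
    = (c / 2) `^ (- p) * s.
  move=> s0; rewrite powRM ?powR_ge0// (powRK_of_mul1 s0); last by field; lra.
  by rewrite -powRrM; congr (_ `^ _ * _); field; lra.
rewrite psi_bound_conj// /psi_bound !pow; [ring|lra|lra].
Qed.

(** The integrand may change sign, so the formula for nonnegative functions is
    applied to its positive and negative parts. *)
Lemma integral_bernoulli_prob_fin (R : realType) (b : R) (f : bool -> R) :
  0 <= b <= 1 ->
  (\int[bernoulli_prob b]_w (f w)%:E = (b * f true + (1 - b) * f false)%R%:E)%E.
Proof.
move=> b01; rewrite integralE !integral_bernoulli_prob//.
have maxB (x : R) : Num.max x 0 - Num.max (- x) 0 = x.
  case: (lerP x 0) => x0; last by rewrite max_r ?oppr_le0 1?ltW//; ring.
  by rewrite max_l ?oppr_ge0//; ring.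
rewrite !funeposE !funenegE /= -!EFin_max -!EFinM -!EFinD; congr EFin.
rewrite -[in RHS](maxB (f true)) -[in RHS](maxB (f false)) /unstable.onem; ring.
Qed.

(** Under the Bernoulli law of parameter b this variable is centered with
    E|X| = 2 when e is 1 or -1; the sign e selects whether the atom of mass b
    lies on the positive or on the negative side. *)
Definition two_point (R : realType) (e b : R) (w : bool) : R :=
  e * (if w then b^-1 else - (1 - b)^-1).

Lemma measurable_two_point (R : realType) (e b : R) :
  measurable_fun setT (two_point e b).
Proof. by []. Qed.

HB.instance Definition _ (R : realType) (e b : R) :=
  isMeasurableFun.Build _ _ _ _ (two_point e b) (measurable_two_point e b).

(** Equality in both of Hoelder's inequalities and in x + y = 1 forces X to be
    constant on each side of zero; the two-point variable is such an X. The set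
    A is a half-line containing exactly the atom of mass psi_bound p c. *)
Lemma attained_psi_bound (R : realType) (p c e : R) (A : set R) : 1 < p -> 0 < c <= 1 ->
  `|e| = 1 -> (forall x, 0 < x -> A (e * x) /\ ~ A (e * - x)) ->
  attainable_probabilities p c A (psi_bound p c)%:E.
Proof.
move=> p1 c01 e1 eA; have /andP[c0 _] := c01.
set b := psi_bound p c.
have /andP[b0 b1] : 0 < b < 1 by exact: psi_bound_itv.
have b1' : 0 < 1 - b by lra.
have b01 : 0 <= b <= 1 by lra.
have nX w : `|two_point e b w| = if w then b^-1 else (1 - b)^-1.
  rewrite /two_point normrM e1 mul1r; case: w; rewrite ?normrN gtr0_norm ?invr_gt0//.
have I1 : (\int[bernoulli_prob b]_w `|two_point e b w|%R%:E = 2%:E)%E.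
  rewrite integral_bernoulli_prob_fin// !nX; congr EFin.
  by rewrite !divff ?gt_eqF.
have Ip : (\int[bernoulli_prob b]_w (`|two_point e b w| `^ p)%R%:E
    = ((c / 2) `^ (- p))%R%:E)%E.
  rewrite integral_bernoulli_prob_fin// !nX -psi_bound_critical//; congr EFin.
  have pow s : 0 < s -> s * s^-1 `^ p = s `^ (- (p - 1)).
    move=> s0; rewrite -[s^-1]powR_inv1 ?ltW// -powRrM mulN1r opprB.
    by rewrite powRD ?powRr1 ?ltW// (gt_eqF s0) implybT.
  by rewrite !pow.
pose P : probability bool R := bernoulli_prob b.
pose X : {RV P >-> R} := two_point e b.
exists _, bool, P, X; split.
- split.
  + split; rewrite unlock; first by rewrite I1 ltry.
    rewrite integral_bernoulli_prob_fin//; congr EFin; rewrite /X /= /two_point /=.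
    by field; rewrite !gt_eqF.
  + move=> [N [mN PN0 sub]].
    have NT : N = setT.
      apply/seteqP; split=> // w _; apply: sub => /= /eqP.
      by rewrite -normr_eq0 nX; case: w; rewrite invr_eq0 gt_eqF.
    by move: PN0; rewrite NT probability_setT => /eqP; rewrite onee_eq0.
  + by rewrite unlock Ip ltry.
- rewrite /moment_ratio /moment_norm Lnorm1/= I1 unlock Ip /=.
  rewrite -powRrM (_ : - p * p^-1 = -1) ?powR_inv1 ?divr_ge0 ?(ltW c0)//; last by field; lra.
  by rewrite invrK mulrCA divff ?mulr1.
- have -> : X @^-1` A = [set true].
    have [in_pos _] : A (e * b^-1) /\ ~ A (e * - b^-1) by apply: eA; rewrite invr_gt0.
    have [_ notin_neg] : A (e * (1 - b)^-1) /\ ~ A (e * - (1 - b)^-1).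
      by apply: eA; rewrite invr_gt0.
    by apply/seteqP; split => -[].
  by rewrite /P /= bernoulli_probE// !diracE mem_set//= memNset//= mule1 mule0 adde0.
Qed.

(** * The bounds and their sharpness *)

Theorem proposition2p1 (R : realType) (p : R) (hp : 1 < p) :
  [/\ {in `[2^-1, 1[ &, forall x y : R, x < y -> psi p y < psi p x}
      /\ set_bij `[2^-1, 1[ `]0, 1] (psi p),
      (forall (d : measure_display) (T : measurableType d)
              (P : probability T R) (X : {RV P >-> R}),
        centered_nonzero_Lp p X ->
        [/\ ((psi_bound p (moment_ratio p X))%:E <= P [set w | 0 < X w]%R)%E,
            (P [set w | 0 < X w]%R <= P [set w | 0 <= X w]%R)%E,
            ((psi_bound p (moment_ratio p X))%:E <= P [set w | X w < 0]%R)%E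
          & (P [set w | X w < 0]%R <= P [set w | X w <= 0]%R)%E]),
      (forall c : R, 0 < c <= 1 ->
        ereal_inf (attainable_probabilities p c [set x | 0 <= x])
          = (psi_bound p c)%:E
        /\ ereal_inf (attainable_probabilities p c [set x | x <= 0])
          = (psi_bound p c)%:E)
    & (forall (d : measure_display) (T : measurableType d)
              (P : probability T R) (X : {RV P >-> R}),
        centered_nonzero_Lp p X ->
        ((explicit_bound p (moment_ratio p X))%:E <= P [set w | 0 < X w]%R)%E
        /\ (P [set w | 0 < X w]%R <= P [set w | 0 <= X w]%R)%E)].
Proof.
have bounds d (T : measurableType d) (P : probability T R) (X : {RV P >-> R}) :
    centered_nonzero_Lp p X ->
    [/\ 0 < moment_ratio p X <= 1,
        ((psi_bound p (moment_ratio p X))%:E <= P [set w | 0 < X w]%R)%E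
      & ((psi_bound p (moment_ratio p X))%:E <= P [set w | X w < 0]%R)%E].
  move=> /(centered_moments hp) [m [A [B [x [y]]]]].
  move=> [[m0 A0 B0] Px Py xy [cE hA hB]].
  have [c0 c1 bx] := psi_bound_le_moments hp m0 A0 B0 xy cE hA hB.
  rewrite addrC in xy; rewrite [A + B]addrC in cE.
  have [_ _ by_] := psi_bound_le_moments hp m0 B0 A0 xy cE hB hA.
  by rewrite c0 c1 Px Py !lee_fin.
have pos_le d (T : measurableType d) (P : probability T R) (X : {RV P >-> R}) :
    (P [set w | 0 < X w]%R <= P [set w | 0 <= X w]%R)%E.
  apply: le_measure; rewrite ?inE; last by move=> w /= /ltW.
  - exact: measurable_ltr_set.
  - exact: measurable_ler_set.
have neg_le d (T : measurableType d) (P : probability T R) (X : {RV P >-> R}) :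
    (P [set w | X w < 0]%R <= P [set w | X w <= 0]%R)%E.
  apply: le_measure; rewrite ?inE; last by move=> w /= /ltW.
  - exact: measurable_ltr_set.
  - exact: measurable_ler_set.
split.
- by split; [exact: psi_decr|exact: psi_bij].
- move=> d T P X hX; have [_ bx by_] := bounds _ _ _ _ hX.
  by split.
- move=> c c01; split; apply/eqP; rewrite eq_le; apply/andP; split.
  + apply: ereal_inf_lbound; apply: (@attained_psi_bound _ _ _ 1) => //.
      exact: normr1.
    move=> x x0 /=; rewrite !mul1r ltW//; split=> //.
    by apply/negP; rewrite -ltNge oppr_lt0.
  + apply: le_ereal_inf_tmp => _ [d [T [P [X [hX <- ->]]]]].
    have [_ bx _] := bounds _ _ _ _ hX; exact: le_trans bx (pos_le _ _ _ _).
  + apply: ereal_inf_lbound; apply: (@attained_psi_bound _ _ _ (- 1)) => //.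
      exact: normrN1.
    move=> x x0 /=; rewrite !mulN1r opprK oppr_le0 ltW//; split=> //.
    by apply/negP; rewrite -ltNge.
  + apply: le_ereal_inf_tmp => _ [d [T [P [X [hX <- ->]]]]].
    have [_ _ by_] := bounds _ _ _ _ hX; exact: le_trans by_ (neg_le _ _ _ _).
- move=> d T P X hX; split; last exact: pos_le.
  have [c01 bx _] := bounds _ _ _ _ hX.
  by apply: le_trans bx; rewrite lee_fin explicit_bound_le.
Qed.
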